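(* There exists a (finite) orthomodular lattice that satisfies the $n$OA law for $n=3,4,5,6$ but fails 3-Go. Consequently it fails $n$-Go for every $n\ge3$, and it does not satisfy all Mayet-Godowski equations.
   Context: Write $a\to b=a'\cup(a\cap b)$. The operation $\overset{(n)}{\equiv}$ is defined by $$a_1\overset{(3)}{\equiv}a_2=((a_1\to a_3)\cap(a_2\to a_3))\cup((a_1'\to a_3)\cap(a_2'\to a_3)),$$ $$a_1\overset{(n)}{\equiv}a_2=(a_1\overset{(n-1)}{\equiv}a_2)\cup((a_1\overset{(n-1)}{\equiv}a_n)\cap(a_2\overset{(n-1)}{\equiv}a_n))\quad (n\ge4).$$ In each subexpression only the two displayed variables are substituted; $a_3$ stays fixed. The $n$OA law is $(a_1\to a_3)\cap(a_1\overset{(n)}{\equiv}a_2)\le a_2\to a_3$. $n$-Go is $$(a_1\to a_2)\cap\cdots\cap(a_{n-1}\to a_n)\cap(a_n\to a_1)=(a_n\to a_{n-1})\cap\cdots\cap(a_2\to a_1)\cap(a_1\to a_n).$$ A Mayet-Godowski equation is a conditional equality $t_1\cap\cdots\cap t_n=u_1\cap\cdots\cap u_n$ ($n\ge2$). Each term is a variable or a join of distinct variables; the hypotheses are that variables within a term are mutually orthogonal ($x\le y'$); and each variable occurs equally often on both sides. *)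

(* Defs.v *)
From mathcomp Require Import all_boot.
Set Implicit Arguments. Unset Strict Implicit. Unset Printing Implicit Defensive.

Record OML := {
  car :> finType;
  jn : car -> car -> car;
  mt : car -> car -> car;
  oc : car -> car;
  zero : car;
  one : car;
  jnC : forall a b, jn a b = jn b a;
  mtC : forall a b, mt a b = mt b a;
  jnA : forall a b c, jn a (jn b c) = jn (jn a b) c;
  mtA : forall a b c, mt a (mt b c) = mt (mt a b) c;
  jn_mt_absorb : forall a b, jn a (mt a b) = a;
  mt_jn_absorb : forall a b, mt a (jn a b) = a;
  mt_zero : forall a, mt zero a = zero;
  jn_one : forall a, jn one a = one;
  ocK : forall a, oc (oc a) = a;
  oc_anti : forall a b, mt a b = a -> mt (oc b) (oc a) = oc b;
  mt_oc : forall a, mt a (oc a) = zero;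
  jn_oc : forall a, jn a (oc a) = one;
  orthomodular : forall a b, mt a b = a -> b = jn a (mt (oc a) b)
}.

Section Ops.
Variable L : OML.

Definition leL (a b : L) : Prop := mt a b = a.

Definition impl (a b : L) : L := jn (oc a) (mt a b).

(* equiv_op k a x y  is  x ==(k+3) y, where a i is the variable a_i
   (only a 3, a 4, ..., a (k+3) are used; a_3 stays fixed). *)
Fixpoint equiv_op (k : nat) (a : nat -> L) (x y : L) : L :=
  match k with
  | 0 => jn (mt (impl x (a 3)) (impl y (a 3)))
            (mt (impl (oc x) (a 3)) (impl (oc y) (a 3)))
  | k'.+1 => jn (equiv_op k' a x y)
                (mt (equiv_op k' a x (a (k'.+4))) (equiv_op k' a y (a (k'.+4))))
  end.

Definition equivn (n : nat) (a : nat -> L) (x y : L) : L := equiv_op (n - 3) a x y.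

Definition nOA_law (n : nat) : Prop :=
  forall a : nat -> L,
    leL (mt (impl (a 1) (a 3)) (equivn n a (a 1) (a 2))) (impl (a 2) (a 3)).

Definition bigmt (s : seq L) : L := foldr (@mt L) (one L) s.
Definition bigjn (s : seq L) : L := foldr (@jn L) (zero L) s.

Definition nGo_law (n : nat) : Prop :=
  forall a : nat -> L,
    mt (bigmt [seq impl (a i) (a i.+1) | i <- iota 1 (n - 1)]) (impl (a n) (a 1))
    = mt (bigmt [seq impl (a i.+1) (a i) | i <- rev (iota 1 (n - 1))]) (impl (a 1) (a n)).

End Ops.

(* Mayet-Godowski equations, syntactically: variables are natural numbers,
   a term is a nonempty duplicate-free list of variables (a variable or a
   join of distinct variables); the equation is t_1 /\ ... /\ t_n =
   u_1 /\ ... /\ u_n with n >= 2 and every variable occurring equally often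
   on both sides. *)
Record MGE := {
  mge_lhs : seq (seq nat);
  mge_rhs : seq (seq nat);
  mge_size : size mge_lhs = size mge_rhs;
  mge_size2 : 2 <= size mge_lhs;
  mge_terms : forall t, t \in mge_lhs ++ mge_rhs -> t != [::] /\ uniq t;
  mge_balanced : forall x : nat,
      count_mem x (flatten mge_lhs) = count_mem x (flatten mge_rhs)
}.

Definition MGE_holds (L : OML) (e : MGE) : Prop :=
  forall v : nat -> L,
    (forall t, t \in mge_lhs e ++ mge_rhs e ->
       forall x y, x \in t -> y \in t -> x != y -> leL (v x) (oc (v y))) ->
    bigmt [seq bigjn [seq v x | x <- t] | t <- mge_lhs e]
    = bigmt [seq bigjn [seq v x | x <- t] | t <- mge_rhs e].

(* Main.v *)
(** The lattice is Godowski's wagon wheel: the rim is a hexagon of three-atom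
    blocks {x_i, y_i, p_i} and {y_i, x_(i+1), q_i}, and each p_i is joined to a
    hub c by a spoke {p_i, r_i, c}.  The hub lies below every x_i \/ y_i = p_i'
    but below no x_(i+1) \/ y_i = q_i', so 3-Go fails at a_i = y_i'.

    For fixed a, let E(x, y) be the ternary biimplication
    ((x -> a) /\ (y -> a)) \/ ((x' -> a) /\ (y' -> a)) and let R(x, y) be the
    join over all z of E(x, z) /\ E(y, z), so that E <= R.  In the wagon wheel
    R(x, z) /\ R(y, z) <= R(x, y) and (x -> a) /\ R(x, y) <= y -> a; hence R
    bounds every iterated biimplication, and the nOA law holds for all n. *)

From HB Require Import structures.
From mathcomp Require Import all_boot.
Require Import Defs.

Set Implicit Arguments. Unset Strict Implicit. Unset Printing Implicit Defensive.

(** * Order, implication and biimplication in an orthomodular lattice *)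

Section OMLTheory.
Variable L : OML.
Implicit Types a b c x y z : L.

Lemma mtxx a : mt a a = a.
Proof. by rewrite -{2}(jn_mt_absorb a a) mt_jn_absorb. Qed.

Lemma mt1x a : mt (one L) a = a.
Proof. by rewrite mtC -(jn_one a) jnC mt_jn_absorb. Qed.

Lemma mtx1 a : mt a (one L) = a.
Proof. by rewrite mtC mt1x. Qed.

Lemma jnx0 a : jn a (zero L) = a.
Proof. by rewrite -(mt_zero a) mtC jn_mt_absorb. Qed.

Lemma leLxx a : leL a a. Proof. exact: mtxx. Qed.

Lemma leL_trans b a c : leL a b -> leL b c -> leL a c.
Proof. by rewrite /leL => ab bc; rewrite -ab -mtA bc. Qed.

Lemma leL_mtl a b : leL (mt a b) a.
Proof. by rewrite /leL mtC mtA mtxx. Qed.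

Lemma leL_mtr a b : leL (mt a b) b.
Proof. by rewrite mtC; apply: leL_mtl. Qed.

Lemma leL_mt a b c : leL c a -> leL c b -> leL c (mt a b).
Proof. by rewrite /leL => ca cb; rewrite mtA ca. Qed.

Lemma leL_jnl a b : leL a (jn a b).
Proof. exact: mt_jn_absorb. Qed.

Lemma leL_jnr a b : leL a (jn b a).
Proof. by rewrite jnC; apply: leL_jnl. Qed.

Lemma leL_jnE a b : leL a b <-> jn a b = b.
Proof.
split=> [ab | <-]; last exact: leL_jnl.
by rewrite -ab jnC mtC jn_mt_absorb.
Qed.

Lemma leL_jn a b c : leL a c -> leL b c -> leL (jn a b) c.
Proof. by move=> /leL_jnE ac /leL_jnE bc; apply/leL_jnE; rewrite -jnA bc ac. Qed.

Lemma leL_mt2 a b c d : leL a b -> leL c d -> leL (mt a c) (mt b d).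
Proof.
move=> ab cd; apply: leL_mt; [apply: leL_trans ab | apply: leL_trans cd].
  exact: leL_mtl.
exact: leL_mtr.
Qed.

Lemma impl_id a : impl a a = one L.
Proof. by rewrite /impl mtxx jnC jn_oc. Qed.

Lemma bigmt_cat (s t : seq L) : bigmt (s ++ t) = mt (bigmt s) (bigmt t).
Proof. by elim: s => [|x s IHs] /=; rewrite ?mt1x // IHs mtA. Qed.

Lemma bigmt_one (s : seq L) : {in s, forall x, x = one L} -> bigmt s = one L.
Proof.
elim: s => //= x s IHs s1; rewrite (s1 x) ?mem_head // mt1x IHs // => y sy.
by apply: s1; rewrite inE sy orbT.
Qed.

Lemma leL_bigjn (s : seq L) x : x \in s -> leL x (bigjn s).
Proof.
elim: s => //= y s IHs; rewrite inE => /predU1P[-> | /IHs xs].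
  exact: leL_jnl.
exact: leL_trans xs (leL_jnr _ _).
Qed.

Definition biimp a x y : L :=
  jn (mt (impl x a) (impl y a)) (mt (impl (oc x) a) (impl (oc y) a)).

(** Here x' lies below x -> a and x lies below x' -> a. *)
Lemma biimp_id a x : biimp a x x = one L.
Proof.
have eq1 y : leL (one L) y -> y = one L by rewrite /leL mt1x.
apply: eq1; rewrite -(jn_oc x) /biimp !mtxx /impl ocK; apply: leL_jn.
  exact: leL_trans (leL_jnl _ _) (leL_jnr _ _).
exact: leL_trans (leL_jnl _ _) (leL_jnl _ _).
Qed.

(** Induction on k: the recursion adds a meet of two factors, each bounded by a value of R, and the
    second hypothesis returns that meet below [R x y]. *)
Lemma equivn_le (R : L -> L -> L) (a : nat -> L) k x y :
    (forall x y, leL (equiv_op 0 a x y) (R x y)) ->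
    (forall x y z, leL (mt (R x z) (R y z)) (R x y)) ->
  leL (equiv_op k a x y) (R x y).
Proof.
move=> R3 Rtr; elim: k x y => [|k IHk] x y; first exact: R3.
apply: leL_jn; first exact: IHk.
exact: leL_trans (leL_mt2 (IHk _ _) (IHk _ _)) (Rtr x y _).
Qed.

(* Padding (a_1, a_2, a_3) with copies of a_3 adds only factors a_3 -> a_3 = 1. *)
Lemma nGo_law3 n : 3 <= n -> nGo_law L n -> nGo_law L 3.
Proof.
case: n => [|[|[|n]]] // _ GoL a.
have := GoL (fun i => a (minn i 3)).
(* The factors of index 1 and 2 are split off on each side; the others have i > 2 and become a_3 ->
   a_3. *)
rewrite !subSS !subn0 /= !rev_cons -!cats1 -!catA /= map_cat bigmt_cat /=.
have ones (f : nat -> L) s : {in s, forall i, f i = one L} ->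
    bigmt [seq f i | i <- s] = one L.
  by move=> f1; apply: bigmt_one => _ /mapP[i si ->]; apply: f1.
have min3 i : 2 < i -> minn i 3 = 3 by move=> /minn_idPr.
rewrite !ones.
- rewrite [minn n.+3 3]min3 //.
  by rewrite !mt1x.
- move=> i; rewrite mem_rev mem_iota => /andP[i3 _].
  by rewrite !min3 ?impl_id // ltnW.
move=> i; rewrite mem_iota => /andP[i3 _].
by rewrite !min3 ?impl_id // ltnW.
Qed.

End OMLTheory.

(* 3-Go is the instance x_i = a_i', y_i = a_i /\ a_(i+1) of this equation, the
   variables being numbered x_1, y_1, x_2, y_2, x_3, y_3. *)
Definition godowski3 : MGE.
Proof.
refine (@Build_MGE [:: [:: 0; 1]; [:: 2; 3]; [:: 4; 5]]
                   [:: [:: 1; 2]; [:: 3; 4]; [:: 5; 0]] erefl isT _ _).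
- move=> t; rewrite !inE; by do 5?[case/orP=> [/eqP-> // |]]; move/eqP->.
- by move=> x; apply: (permP (_ : perm_eq _ _)).
Defined.

Lemma godowski3_nGo (L : OML) : MGE_holds L godowski3 -> nGo_law L 3.
Proof.
move=> holds a.
pose v i := nth (zero L) [:: oc (a 1); mt (a 1) (a 2); oc (a 2); mt (a 2) (a 3);
  oc (a 3); mt (a 3) (a 1)] i.
have orth (b c : L) : leL b c -> leL (oc c) (oc b) /\ leL b (oc (oc c)).
  by move=> bc; split; [apply: oc_anti | rewrite ocK].
have vP t : t \in mge_lhs godowski3 ++ mge_rhs godowski3 ->
    forall x y, x \in t -> y \in t -> x != y -> leL (v x) (oc (v y)).
  rewrite !inE.
  by do 5?[case/orP]; move/eqP->; move=> x y; rewrite !inE;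
    case/orP=> /eqP-> /orP[] /eqP-> //= _;
    first [exact: (orth _ _ (leL_mtl _ _)).1 | exact: (orth _ _ (leL_mtr _ _)).1
          |exact: (orth _ _ (leL_mtl _ _)).2 | exact: (orth _ _ (leL_mtr _ _)).2].
have implE (b c : L) : jn (mt b c) (oc c) = impl c b by rewrite jnC mtC.
have := holds v vP; rewrite /= /v /= !jnx0 !mtx1 !implE -!/(impl _ _) => eqv.
(* On the right, 3-Go lists the first two factors in the opposite order. *)
by rewrite -mtA eqv mtA [mt (impl _ _) (impl (a 3) _)]mtC.
Qed.

(** * Logics with three-atom blocks *)

(* mid a b is the common neighbour of a and b in the orthogonality graph; its
   value at a = b is junk. *)
Section Greechie.
Variables (T : finType) (perp : rel T) (mid : T -> T -> option T).
Hypotheses (perp_irr : irreflexive perp) (perp_sym : symmetric perp).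
(** Uniqueness of common neighbours excludes loops of fewer than five blocks; [perp_mid] completes
    every orthogonal pair to a three-atom block. *)
Hypothesis midP :
  forall a b c, a != b -> (mid a b == Some c) = perp a c && perp b c.
Hypothesis perp_mid : forall a b, perp a b -> mid a b.

(* (false, Some a) is the atom a, (true, Some a) the coatom a', and
   (false, None), (true, None) are 0 and 1. *)
Definition logic := (bool * option T)%type.
Implicit Types x y z : logic.

Definition lcompl x : logic := (~~ x.1, x.2).

Definition lle x y : bool :=
  match x, y with
  | (false, None), _ | _, (true, None) => true
  | (false, Some a), (true, Some b) => perp a b
  | (s, Some a), (s', Some b) => (s == s') && (a == b)
  | _, _ => false
  end.

(** The atoms below distinct coatoms a' and b' are the common neighbours of a and b, so [mid a b]
    gives their meet, [None] standing for 0. *)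
Definition lmeet x y : logic :=
  match x, y with
  | (false, None), _ | _, (false, None) => (false, None)
  | (true, None), z | z, (true, None) => z
  | (false, Some a), (false, Some b) => if a == b then x else (false, None)
  | (false, Some a), (true, Some b) => if perp a b then x else (false, None)
  | (true, Some b), (false, Some a) => if perp a b then y else (false, None)
  | (true, Some a), (true, Some b) => if a == b then x else (false, mid a b)
  end.

Definition ljoin x y := lcompl (lmeet (lcompl x) (lcompl y)).

Lemma lcomplK x : lcompl (lcompl x) = x.
Proof. by case: x => [[] o]. Qed.

Lemma lle_refl x : lle x x.
Proof. by case: x => [[] [a|]] //=; rewrite eqxx. Qed.

Lemma lle_anti x y : lle x y -> lle y x -> x = y.
Proof. by case: x y => [[] [a|]] [[] [b|]] //= /eqP->. Qed.

Lemma lle_compl x y : lle (lcompl y) (lcompl x) = lle x y.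
Proof. by case: x y => [[] [a|]] [[] [b|]] //=; rewrite eq_sym. Qed.

(** The universal property of meets, from which the lattice identities follow; for two distinct
    coatoms it amounts to [midP]. *)
Lemma lle_meet z x y : lle z (lmeet x y) = lle z x && lle z y.
Proof.
have atom_coatom a b : lle z (if perp a b then (false, Some a) else (false, None)) =
    lle z (false, Some a) && lle z (true, Some b).
  by case: ifP => ab; case: z => [[] [c|]] //=; case: eqP => [->|] //=.
case: x y => [[] [a|]] [[] [b|]] /=;
  try by case: z {atom_coatom} => [[] [c|]] /=; rewrite ?andbT ?andbF.
- case: eqVneq => [<- | ab]; first by rewrite andbb.
  case: z {atom_coatom} => [[] [c|]] //=.
    transitivity false; first by case: mid.
    by apply/esym/negbTE; apply: contra ab => /andP[/eqP<- /eqP<-].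
  by rewrite ![perp c _]perp_sym -midP //.
- by rewrite atom_coatom andbC.
- exact: atom_coatom.
- case: eqVneq => [<- | ab]; first by rewrite andbb.
  case: z {atom_coatom} => [[] [c|]] //=.
  by apply/esym/negbTE; apply: contra ab => /andP[/eqP<- /eqP<-].
Qed.

Lemma lmeet_idPl x y : lmeet x y = x <-> lle x y.
Proof.
split=> [<- | xy]; first by have := lle_refl (lmeet x y); rewrite lle_meet => /andP[].
apply: lle_anti; last by rewrite lle_meet lle_refl.
by have := lle_refl (lmeet x y); rewrite lle_meet => /andP[].
Qed.

Lemma lle_meetl_eq x y : (forall z, lle z x = lle z y) -> x = y.
Proof. by move=> xy; apply: lle_anti; [rewrite -xy | rewrite xy]; apply: lle_refl. Qed.

Lemma lmeetC x y : lmeet x y = lmeet y x.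
Proof. by apply: lle_meetl_eq => z; rewrite !lle_meet andbC. Qed.

Lemma lmeetA x y z : lmeet x (lmeet y z) = lmeet (lmeet x y) z.
Proof. by apply: lle_meetl_eq => t; rewrite !lle_meet andbA. Qed.

Lemma ljoinC x y : ljoin x y = ljoin y x.
Proof. by rewrite /ljoin lmeetC. Qed.

Lemma ljoinA x y z : ljoin x (ljoin y z) = ljoin (ljoin x y) z.
Proof. by rewrite /ljoin !lcomplK lmeetA. Qed.

Lemma lmeetK x y : lmeet x (ljoin x y) = x.
Proof.
apply/lmeet_idPl; rewrite -lle_compl lcomplK.
by have := lle_refl (lmeet (lcompl x) (lcompl y)); rewrite lle_meet => /andP[].
Qed.

Lemma ljoinK x y : ljoin x (lmeet x y) = x.
Proof.
rewrite -[RHS]lcomplK -[in RHS](lmeetK (lcompl x) (lcompl y)).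
by rewrite /ljoin !lcomplK.
Qed.

Lemma lmeet_compl_anti x y :
  lmeet x y = x -> lmeet (lcompl y) (lcompl x) = lcompl y.
Proof. by move/lmeet_idPl=> xy; apply/lmeet_idPl; rewrite lle_compl. Qed.

Lemma lmeet0 x : lmeet (false, None) x = (false, None).
Proof. by apply/lmeet_idPl. Qed.

Lemma ljoin1 x : ljoin (true, None) x = (true, None).
Proof. by rewrite /ljoin lmeet0. Qed.

Lemma lmeetN x : lmeet x (lcompl x) = (false, None).
Proof. by case: x => [[] [a|]] //=; rewrite perp_irr. Qed.

Lemma ljoinN x : ljoin x (lcompl x) = (true, None).
Proof. by rewrite /ljoin lmeetN. Qed.

(** The main case is an atom a below a coatom b': if c is the third atom of their block, then a' /\
    b' = c and a \/ c = b'. *)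
Lemma logic_orthomodular x y :
  lmeet x y = x -> y = ljoin x (lmeet (lcompl x) y).
Proof.
move/lmeet_idPl; case: x y => [[] [a|]] [[] [b|]] //=;
  rewrite /ljoin /= ?perp_irr //.
- by move/eqP->; rewrite perp_irr.
- move=> ab; have neq_ab : a != b by apply: contraTneq ab => ->; rewrite perp_irr.
  have:= perp_mid ab; case Dc: (mid a b) => [c|] // _; rewrite (negPf neq_ab) /=.
  have /andP[ac bc]: perp a c && perp b c by rewrite -midP ?Dc.
  have neq_ac : a != c by apply: contraTneq ac => ->; rewrite perp_irr.
  suffices /eqP->: mid a c == Some b by rewrite (negPf neq_ac).
  by rewrite midP // ab perp_sym.
- by move/eqP->; rewrite perp_irr.
Qed.

Definition logic_OML : OML :=
  @Build_OML logic ljoin lmeet lcompl (false, None) (true, None)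
    ljoinC lmeetC ljoinA lmeetA ljoinK lmeetK lmeet0 ljoin1 lcomplK
    lmeet_compl_anti lmeetN ljoinN logic_orthomodular.

End Greechie.

(** * The wagon wheel *)

Variant idx3 := I0 | I1 | I2.
Definition succ3 i := match i with I0 => I1 | I1 => I2 | I2 => I0 end.

Variant atom := X of idx3 | Y of idx3 | P of idx3 | Q of idx3 | R of idx3 | Hub.

Definition blocks : seq (seq atom) :=
  flatten [seq [:: [:: X i; Y i; P i]; [:: Y i; X (succ3 i); Q i];
                   [:: P i; R i; Hub]] | i <- [:: I0; I1; I2]].

Definition atoms : seq atom :=
  Hub :: flatten [seq [:: X i; Y i; P i; Q i; R i] | i <- [:: I0; I1; I2]].

Definition atom_eqb (a b : atom) : bool :=
  match a, b with
  | X I0, X I0 | X I1, X I1 | X I2, X I2 | Y I0, Y I0 | Y I1, Y I1 | Y I2, Y I2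
  | P I0, P I0 | P I1, P I1 | P I2, P I2 | Q I0, Q I0 | Q I1, Q I1 | Q I2, Q I2
  | R I0, R I0 | R I1, R I1 | R I2, R I2 | Hub, Hub => true
  | _, _ => false
  end.

Lemma atom_eqP : Equality.axiom atom_eqb.
Proof.
by move=> a b; apply: (iffP idP) => [|<-];
  [case: a => [[]|[]|[]|[]|[]|]; case: b => [[]|[]|[]|[]|[]|]
  |case: a => [[]|[]|[]|[]|[]|]].
Qed.

HB.instance Definition _ := hasDecEq.Build atom atom_eqP.

Lemma atom_codeK : @pcancel nat atom (fun a => index a atoms) (onth atoms).
Proof. by case=> [[]|[]|[]|[]|[]|]. Qed.

HB.instance Definition _ := PCanIsCountable atom_codeK.

Lemma atoms_enumP : Finite.axiom atoms.
Proof. by case=> [[]|[]|[]|[]|[]|]. Qed.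

HB.instance Definition _ := isFinite.Build atom atoms_enumP.

Lemma atoms_all (p : pred atom) : all p atoms -> forall a, p a.
Proof. by move/allP=> pa a; apply: pa; case: a => [[]|[]|[]|[]|[]|]. Qed.

(* Both graph functions are tabulated as 16 x 16 matches: the kernel evaluates
   them millions of times in the check of the orthoarguesian laws. *)
Definition perp_table a b :
  {r | r = (a != b) && has (fun B => (a \in B) && (b \in B)) blocks}.
Proof.
by case: a => [[]|[]|[]|[]|[]|]; case: b => [[]|[]|[]|[]|[]|];
  eexists; vm_compute; reflexivity.
Defined.

Definition perp a b : bool := sval (perp_table a b).

Definition mid_table a b :
  {r | r = ohead [seq c <- atoms | perp a c && perp b c]}.
Proof.
by case: a => [[]|[]|[]|[]|[]|]; case: b => [[]|[]|[]|[]|[]|];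
  eexists; vm_compute; reflexivity.
Defined.

Definition mid a b : option atom := sval (mid_table a b).

Lemma perp_irr : irreflexive perp.
Proof. by case=> [[]|[]|[]|[]|[]|]. Qed.

Lemma perp_sym : symmetric perp.
Proof.
move=> a b; apply/eqP; move: b; apply: atoms_all; move: a; apply: atoms_all.
by vm_compute.
Qed.

Lemma midP a b c :
  a != b -> (mid a b == Some c) = perp a c && perp b c.
Proof.
suff: (a != b) ==> ((mid a b == Some c) == (perp a c && perp b c)).
  by move=> /implyP/[apply]/eqP.
move: c; apply: atoms_all; move: b; apply: atoms_all; move: a; apply: atoms_all.
by vm_compute.
Qed.

Lemma perp_mid a b : perp a b -> mid a b.
Proof.
apply/implyP; move: b; apply: atoms_all; move: a; apply: atoms_all.
by vm_compute.
Qed.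

Definition wheel : OML := @logic_OML atom perp mid perp_irr perp_sym midP perp_mid.

(** * A sufficient condition for all the orthoarguesian laws *)

Section Orthoarguesian.
Variables (L : OML) (elts : seq L).
Hypothesis elts_full : forall x, x \in elts.
Implicit Types (E F : L -> L -> L) (M N : seq (seq L)).

(** The matrix product of E with its transpose, with join as sum and meet as product. *)
Definition comp E x y : L := bigjn [seq mt (E x z) (E y z) | z <- elts].

Lemma leL_comp E x y z : leL (mt (E x z) (E y z)) (comp E x y).
Proof. exact/leL_bigjn/map_f. Qed.

(** For R = [comp (biimp a)], idempotence turns R(x, z) /\ R(y, z) <= [comp R x y] into the
    transitivity that [equivn_le] requires. *)
Lemma nOA_of_idempotent_comp n :
    (forall a x y,
       comp (comp (biimp a)) x y = comp (biimp a) x y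
       /\ leL (mt (impl x a) (comp (biimp a) x y)) (impl y a)) ->
  nOA_law L n.
Proof.
move=> compP a; apply: leL_trans (compP (a 3) (a 1) (a 2)).2.
apply: leL_mt2 (leLxx _) _; apply: equivn_le => [x y | x y z].
  (* The term z = y of the join is E(x, y), because E(y, y) = 1. *)
  have := leL_comp (biimp (a 3)) x y y; rewrite biimp_id mtx1; exact.
by rewrite -(compP (a 3) x y).1; apply: leL_comp.
Qed.

(** Tabulated matrices let evaluation share the entries of R instead of recomputing them inside the
    second product. *)
Definition mx E : seq (seq L) := [seq [seq E x y | y <- elts] | x <- elts].

Definition sqmx M : seq (seq L) :=
  [seq [seq bigjn [seq mt p.1 p.2 | p <- zip r s] | s <- M] | r <- M].

Definition biimp_mx a : seq (seq L) :=
  let v := [seq (impl x a, impl (oc x) a) | x <- elts] in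
  [seq [seq jn (mt p.1 q.1) (mt p.2 q.2) | q <- v] | p <- v].

Definition OA_check a : bool :=
  let u := [seq impl x a | x <- elts] in
  let M := sqmx (biimp_mx a) in
  (sqmx M == M) &&
  all2 (fun x r => all2 (fun y e => let m := mt x e in mt m y == m) u r) u M.

Lemma sqmx_mx E : sqmx (mx E) = mx (comp E).
Proof.
rewrite /sqmx /mx -map_comp; apply: eq_map => x /=.
rewrite -map_comp; apply: eq_map => y /=.
by rewrite zip_map -map_comp.
Qed.

Lemma biimp_mxE a : biimp_mx a = mx (biimp a).
Proof.
by rewrite /biimp_mx -map_comp; apply: eq_map => x /=; rewrite -map_comp.
Qed.

Lemma mx_inj E F : mx E = mx F -> forall x y, E x y = F x y.
Proof. by move=> EF x y; move/eq_in_map/(_ x (elts_full x))/eq_in_map: EF; apply. Qed.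

Lemma all2_map2 (A B : Type) (p : A -> B -> bool) (f : L -> A) (g : L -> B) :
  all2 p [seq f x | x <- elts] [seq g x | x <- elts] -> forall x, p (f x) (g x).
Proof.
move=> pfg x; have := elts_full x.
elim: elts pfg => //= y s IHs /andP[py /IHs ps].
by rewrite inE => /predU1P[-> | /ps].
Qed.

Lemma nOA_of_check n : all OA_check elts -> nOA_law L n.
Proof.
move=> /allP ok; apply: nOA_of_idempotent_comp => a x y.
have /andP[] := ok a (elts_full a).
rewrite biimp_mxE !sqmx_mx => /eqP/mx_inj-> /all2_map2-/(_ x).
by move=> /all2_map2-/(_ y)/eqP.
Qed.

End Orthoarguesian.

(** * Verification in the wagon wheel *)

Definition wheel_elts : seq wheel :=
  [seq (s, o) | s <- [:: false; true], o <- None :: [seq Some a | a <- atoms]].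

Lemma wheel_elts_full x : x \in wheel_elts.
Proof. by case: x => [[] [[[]|[]|[]|[]|[]|]|]]. Qed.

(** Exhaustive evaluation over the 34 elements: each a takes two products of 34 by 34 matrices. *)
Lemma wheel_OA_check : all (OA_check wheel_elts) wheel_elts.
Proof. by vm_compute. Qed.

Lemma wheel_not_3Go : ~ nGo_law wheel 3.
Proof.
pose coatom b : wheel := (true, Some b).
(* Indexing from 0 puts y_0', y_1', y_2' at a_1, a_2, a_3. As x_(i+1) is the common neighbour of y_i
   and y_(i+1), the left side is the meet of the q_i', which is 0, and the right side that of the
   p_i', which is the hub. *)
pose a := [:: coatom Hub; coatom (Y I0); coatom (Y I1); coatom (Y I2)].
by move=> /(_ (nth (one wheel) a))/eqP; vm_compute.
Qed.

Theorem theorem6p9 :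
  exists L : OML,
    (forall n : nat, 3 <= n <= 6 -> nOA_law L n) /\
    ~ nGo_law L 3 /\
    (forall n : nat, 3 <= n -> ~ nGo_law L n) /\
    ~ (forall e : MGE, MGE_holds L e).
Proof.
exists wheel; split=> [n _|].
  exact: nOA_of_check wheel_elts_full n wheel_OA_check.
split; first exact: wheel_not_3Go.
split=> [n n3 /(nGo_law3 n3) | /(_ godowski3)/godowski3_nGo]; exact: wheel_not_3Go.
Qed.
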